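(* Let $n\ge 2$, let $$\Omega=\{(i,i): 1\le i\le n\}\cup\{(i,i-1): 2\le i\le n\}\cup\{(1,n)\},$$ and let $A_{ij}>0$ for $(i,j)\in\Omega$. Let $z^*\in\mathbb R^{2n}$ be an optimal solution of the problem $(\mathrm P)$ defined in the context, and let $\mathcal K$ be either $\mathbb S^{2n}_+$ or $\mathcal{DNN}^{2n}$. If $$\frac{z^*_{n+j}}{z^*_i}\in\left[1,\sqrt{1+\tfrac{1}{n-1}}\right]\qquad\text{for all }(i,j)\in\Omega,$$ then for each $\theta\in\{0,1\}$ the conic relaxation $(\mathrm R_\theta)$ defined in the context admits $z^*(z^* )^T$ as a rank-one optimal solution. Consequently, the relaxation $(\mathrm R_0)$ of $(\mathrm P)$ and the relaxation $(\mathrm R_1)$ of $(\mathrm P')$ are both tight.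
   Context: $\mathbb S^s$: real symmetric $s\times s$ matrices; $\mathbb S^s_+$: positive semidefinite ones; $\mathcal{DNN}^s$: those that are positive semidefinite and elementwise nonnegative. $M\bullet N=\mathrm{trace}(MN)$. $E_{ii}=e^i(e^i)^T$ and $E_{ij}=e^i(e^j)^T+e^j(e^i)^T$ for $i\neq j$. The problems below come from completing a partially specified $n\times n$ matrix $(A_{ij})_{(i,j)\in\Omega}$ to a rank-one nonnegative matrix. $(\mathrm P)$: minimize $\sum_{i=1}^{2n}z_i^2$ over $z\in\mathbb R^{2n}$ subject to $A_{ij}-z_iz_{n+j}=0$ for $(i,j)\in\Omega$, $\sum_{i=1}^{2n}z_i^2\le r$, $z_1=1$, $z\ge 0$. $(\mathrm P')$: minimize $\sum_{i=1}^{2n}z_i^2+2\rho\sum_{(i,j)\in\Omega}z_iz_{n+j}$ over $z\in\mathbb R^{2n}$ subject to $A_{ij}-z_iz_{n+j}\le 0$ for $(i,j)\in\Omega$, $\sum_{i=1}^{2n}z_i^2\le r$, $z_1=1$, $z\ge0$. $(\mathrm R_\theta)$, $\theta\in\{0,1\}$: minimize $\big(I+\theta\rho\sum_{(i,j)\in\Omega}E_{i,n+j}\big)\bullet Z$ over $Z\in\mathcal K$ subject to $(2A_{ij}E_{11}-E_{i,n+j})\bullet Z=0$ if $\theta=0$, respectively $\le 0$ if $\theta=1$, for $(i,j)\in\Omega$; $(I-rE_{11})\bullet Z\le 0$; $Z_{11}=1$; $E_{1j}\bullet Z\ge 0$ for $j=2,\dots,2n$. $(\mathrm R_0)$ is a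 relaxation of $(\mathrm P)$ and $(\mathrm R_1)$ is a relaxation of $(\mathrm P')$. A relaxation is tight if its optimal value equals that of the problem it relaxes. $r>0$ and $\rho>0$ are fixed constants (the same in all problems) taken sufficiently large: the claim is asserted for all $r\ge r_0$ and $\rho\ge\rho_0$, for some thresholds $r_0,\rho_0>0$ depending only on $n,\Omega,A$. *)

(* Defs.v *)
From mathcomp Require Import all_boot all_order all_algebra.
From mathcomp Require Import all_classical reals ereal.

Set Implicit Arguments.
Unset Strict Implicit.
Unset Printing Implicit Defensive.

Import Order.TTheory GRing.Theory Num.Theory.

Local Open Scope classical_set_scope.
Local Open Scope ring_scope.

Definition optimal_solution (R : realType) (T : Type) (feasible : set T)
    (obj : T -> R) (x : T) : Prop :=
  feasible x /\ forall y, feasible y -> obj x <= obj y.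

(* Infimum in the extended reals: +oo if infeasible, -oo if unbounded. *)
Definition optimal_value (R : realType) (T : Type) (feasible : set T)
    (obj : T -> R) : \bar R :=
  ereal_inf [set (obj x)%:E | x in feasible].

Definition frob (R : realType) (m : nat) (M N : 'M[R]_m) : R := \tr (M *m N).

Definition symE (R : realType) (m : nat) (i j : 'I_m) : 'M[R]_m :=
  if i == j then delta_mx i i else delta_mx i j + delta_mx j i.

Definition psd_cone (R : realType) (m : nat) : set 'M[R]_m :=
  [set M | M^T = M /\ forall x : 'cV[R]_m, 0 <= (x^T *m M *m x) 0 0].

Definition dnn_cone (R : realType) (m : nat) : set 'M[R]_m :=
  [set M | psd_cone M /\ forall i j, 0 <= M i j].

(* Indices are 0-based: all (i,i), the (i,i-1) with i > 0, and (0,n-1). *)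
Definition Omega (n : nat) : {set 'I_n * 'I_n} :=
  [set p : 'I_n * 'I_n | [|| p.1 == p.2,
                             val p.1 == (val p.2).+1
                           | (val p.1 == 0%N) && (val p.2 == n.-1)]].

(* A vector of R^(2n) is indexed by 'I_(n + n): its coordinates z_i and
   z_(n+j), for i, j <= n, sit at [lshift n i] and [rshift n j]. *)
Definition fst_idx (n : nat) (hn : (1 < n)%N) : 'I_(n + n) :=
  lshift n (Ordinal (ltnW hn)).

Definition P_feasible (R : realType) (n : nat) (hn : (1 < n)%N) (A : 'M[R]_n)
    (r : R) : set 'cV[R]_(n + n) :=
  [set z | [/\ forall i j, (i, j) \in Omega n ->
                 A i j - z (lshift n i) 0 * z (rshift n j) 0 = 0,
               \sum_i z i 0 ^+ 2 <= r,
               z (fst_idx hn) 0 = 1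
             & forall i, 0 <= z i 0]].

Definition P_obj (R : realType) (n : nat) (z : 'cV[R]_(n + n)) : R :=
  \sum_i z i 0 ^+ 2.

Definition P'_feasible (R : realType) (n : nat) (hn : (1 < n)%N) (A : 'M[R]_n)
    (r : R) : set 'cV[R]_(n + n) :=
  [set z | [/\ forall i j, (i, j) \in Omega n ->
                 A i j - z (lshift n i) 0 * z (rshift n j) 0 <= 0,
               \sum_i z i 0 ^+ 2 <= r,
               z (fst_idx hn) 0 = 1
             & forall i, 0 <= z i 0]].

Definition P'_obj (R : realType) (n : nat) (rho : R) (z : 'cV[R]_(n + n)) : R :=
  \sum_i z i 0 ^+ 2
  + 2 * rho * \sum_(p in Omega n) z (lshift n p.1) 0 * z (rshift n p.2) 0.

(* The parameter theta in {0, 1} is a boolean, read in R as [theta%:R]. *)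
Definition R_feasible (R : realType) (n : nat) (hn : (1 < n)%N) (A : 'M[R]_n)
    (r : R) (K : set 'M[R]_(n + n)) (theta : bool) : set 'M[R]_(n + n) :=
  let e1 := fst_idx hn in
  [set Z | [/\ K Z,
               forall i j, (i, j) \in Omega n ->
                 let c := frob ((2 * A i j) *: symE R e1 e1
                                - symE R (lshift n i) (rshift n j)) Z in
                 if theta return Prop then c <= 0 else c = 0,
               frob (1%:M - r *: symE R e1 e1) Z <= 0,
               Z e1 e1 = 1
             & forall j, j != e1 -> 0 <= frob (symE R e1 j) Z]].

Definition R_obj (R : realType) (n : nat) (rho : R) (theta : bool)
    (Z : 'M[R]_(n + n)) : R :=
  frob (1%:M + (theta%:R * rho) *:
          \sum_(p in Omega n) symE R (lshift n p.1) (rshift n p.2)) Z.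

(* Main.v *)
Require Import Defs.
From mathcomp Require Import all_boot all_order all_algebra.
From mathcomp Require Import all_classical reals ereal.
From mathcomp Require Import ring lra zify.

Set Implicit Arguments.
Unset Strict Implicit.
Unset Printing Implicit Defensive.

Import Order.TTheory GRing.Theory Num.Theory.

Local Open Scope classical_set_scope.
Local Open Scope ring_scope.

(** Write u_i and v_j for the coordinates z_i and z_(n+j), numbered from 1, and
    index the rows and columns of Z by these vertices.  The graph Omega is
    a single cycle through the 2n vertices u_i, v_j, and optimality of
    [z *m z^T] is certified by weights x_ij >= 0 on its edges such that the
    edges at v_j have total weight v_j^2, and those at u_i total weight u_i^2
    except at the vertex u_1, where Z is fixed to 1 and the total only
    contributes a constant.  Indeed a positive semidefinite Z satisfies
      2 Z(u_i, v_j) / (u_i v_j) <= Z(u_i, u_i) / u_i^2 + Z(v_j, v_j) / v_j^2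
    on each edge.  If moreover Z(u_i, v_j) >= u_i v_j on Omega, the left-hand
    side is at least 2; multiplying by x_ij and summing over the edges gives
    sum_i z_i^2 <= tr Z ([trace_ge_of_ratio]).  In terms of duality, the x_ij
    are the weights of a graph Laplacian which, rescaled by z, is the dual
    slack matrix; it is positive semidefinite and annihilates z.

    Such weights are found by going around the cycle: all are determined by one
    of them, and putting weight 0 on the edge (n,n) gives
      x_jj = sum_(j <= l < n) (v_l^2 - u_(l+1)^2),
      x_(j+1,j) = v_j^2 - x_jj = u_(j+1)^2 - x_(j+1,j+1),  x_(1,n) = v_n^2.
    The lower bound v_j >= u_i of the ratio hypothesis makes x_jj >= 0.  Its
    upper bound gives (n-1) x_jj <= (n-j) u_j^2 by downward induction on j
    ([tail_gap_bound]), hence x_jj <= u_j^2, so that the other weights are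
    nonnegative too ([cycle_weights]).

    The trace bound uses the constraints on Omega as inequalities only, so it
    serves both values of theta; the penalty term of the case theta = 1 is
    bounded below entry by entry.  The weights depend on z alone, so the same
    certificate works for all positive r and rho, whence the thresholds 1.
    Tightness follows because y |-> y y^T embeds the feasible set of each
    nonconvex problem into that of its relaxation with equal objectives, and
    the optimum z z^T of the relaxation lies in the image. *)

(** * Entries of the matrices in the relaxation *)

Lemma frobDl (R : realType) (m : nat) (M N Z : 'M[R]_m) :
  frob (M + N) Z = frob M Z + frob N Z.
Proof. by rewrite /frob mulmxDl mxtraceD. Qed.

Lemma frobZl (R : realType) (m : nat) (a : R) (M Z : 'M[R]_m) :
  frob (a *: M) Z = a * frob M Z.
Proof. by rewrite /frob -scalemxAl mxtraceZ. Qed.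

Lemma frobBl (R : realType) (m : nat) (M N Z : 'M[R]_m) :
  frob (M - N) Z = frob M Z - frob N Z.
Proof. by rewrite frobDl -scaleN1r frobZl mulN1r. Qed.

Lemma frob1l (R : realType) (m : nat) (Z : 'M[R]_m) : frob 1%:M Z = \tr Z.
Proof. by rewrite /frob mul1mx. Qed.

Lemma frob_suml (R : realType) (m : nat) (I : finType) (P : pred I)
    (F : I -> 'M[R]_m) (Z : 'M[R]_m) :
  frob (\sum_(i | P i) F i) Z = \sum_(i | P i) frob (F i) Z.
Proof. by rewrite /frob mulmx_suml raddf_sum. Qed.

Lemma frob_delta (R : realType) (m : nat) (i j : 'I_m) (Z : 'M[R]_m) :
  frob (delta_mx i j) Z = Z j i.
Proof.
rewrite /frob -[delta_mx i j](mul_delta_mx (0 : 'I_1)) -mulmxA mxtrace_mulC.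
by rewrite -rowE -colE /mxtrace big_ord1 !mxE.
Qed.

Lemma frob_symE_diag (R : realType) (m : nat) (i : 'I_m) (Z : 'M[R]_m) :
  frob (symE R i i) Z = Z i i.
Proof. by rewrite /symE eqxx frob_delta. Qed.

Lemma frob_symE (R : realType) (m : nat) (i j : 'I_m) (Z : 'M[R]_m) :
  Z^T = Z -> i != j -> frob (symE R i j) Z = 2 * Z i j.
Proof.
move=> /matrixP/(_ i j); rewrite mxE => symZ /negbTE neq_ij.
by rewrite /symE neq_ij frobDl !frob_delta symZ; ring.
Qed.

Lemma R_objE (R : realType) (n : nat) (rho : R) (theta : bool)
    (Z : 'M[R]_(n + n)) : Z^T = Z ->
  R_obj rho theta Z = \tr Z + 2 * (theta%:R * rho) *
    \sum_(p in Omega n) Z (lshift n p.1) (rshift n p.2).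
Proof.
move=> symZ; rewrite /R_obj frobDl frob1l frobZl frob_suml.
under eq_bigr => p _ do rewrite frob_symE ?eq_lrshift//.
by rewrite -mulr_sumr; ring.
Qed.

Lemma frob_entry_constraint (R : realType) (n : nat) (k : 'I_(n + n))
    (i j : 'I_n) (a : R) (Z : 'M[R]_(n + n)) : Z^T = Z -> Z k k = 1 ->
  frob ((2 * a) *: symE R k k - symE R (lshift n i) (rshift n j)) Z
  = 2 * (a - Z (lshift n i) (rshift n j)).
Proof.
move=> symZ Zk; rewrite frobBl frobZl frob_symE_diag Zk frob_symE ?eq_lrshift//.
ring.
Qed.

(** Nonnegativity of the form at a e_k - b e_l. *)
Lemma psd_cone_quad2 (R : realType) (m : nat) (Z : 'M[R]_m) (k l : 'I_m)
    (a b : R) : psd_cone Z ->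
  2 * (a * b * Z k l) <= a ^+ 2 * Z k k + b ^+ 2 * Z l l.
Proof.
pose d i : 'cV[R]_m := delta_mx i 0.
move=> [/matrixP/(_ k l) + /(_ (a *: d k - b *: d l))]; rewrite mxE => symZ.
have entry i j : (d i)^T *m Z *m d j = (Z i j)%:M.
  by apply/matrixP=> p q; rewrite trmx_delta -rowE -colE !ord1 !mxE.
have -> : (a *: d k - b *: d l)^T = a *: (d k)^T - b *: (d l)^T.
  by rewrite linearB !linearZ.
rewrite !mulmxBl !mulmxBr -!scalemxAr -!scalemxAl.
rewrite !entry !mxE eqxx !mulr1n symZ; lra.
Qed.

(** * Rank-one points of the relaxation *)

Lemma outerE (R : realType) (m : nat) (z : 'cV[R]_m) (i j : 'I_m) :
  (z *m z^T) i j = z i 0 * z j 0.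
Proof. by rewrite mxE big_ord1 !mxE. Qed.

Lemma outer_sym (R : realType) (m : nat) (z : 'cV[R]_m) :
  (z *m z^T)^T = z *m z^T.
Proof. by rewrite trmx_mul trmxK. Qed.

Lemma outer_psd (R : realType) (m : nat) (z : 'cV[R]_m) :
  psd_cone (z *m z^T).
Proof.
split=> [|x]; first exact: outer_sym.
have -> : x^T *m (z *m z^T) *m x = (x^T *m z) *m (x^T *m z)^T.
  by rewrite trmx_mul trmxK !mulmxA.
by rewrite outerE -expr2 sqr_ge0.
Qed.

Lemma mxtrace_outer (R : realType) (m : nat) (z : 'cV[R]_m) :
  \tr (z *m z^T) = \sum_i z i 0 ^+ 2.
Proof. by apply: eq_bigr => i _; rewrite outerE. Qed.

Lemma rank_outer (R : realType) (m : nat) (z : 'cV[R]_m) (k : 'I_m) :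
  z k 0 = 1 -> \rank (z *m z^T) = 1%N.
Proof.
move=> zk; apply/eqP; rewrite eqn_leq; apply/andP; split.
  exact: leq_trans (mxrankM_maxl _ _) (rank_leq_col _).
rewrite lt0n mxrank_eq0; apply/eqP => /matrixP/(_ k k).
by rewrite outerE zk mxE mulr1 => /eqP; rewrite oner_eq0.
Qed.

(** The family indexed by theta lets one argument treat both the pair (P), (R_0)
    and the pair (P'), (R_1). *)
Definition Ptheta_feasible (R : realType) (n : nat) (hn : (1 < n)%N)
    (A : 'M[R]_n) (r : R) (theta : bool) : set 'cV[R]_(n + n) :=
  if theta then P'_feasible hn A r else P_feasible hn A r.

Definition Ptheta_obj (R : realType) (n : nat) (rho : R) (theta : bool) :
    'cV[R]_(n + n) -> R :=
  if theta then P'_obj rho else @P_obj R n.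

Lemma R_obj_outer (R : realType) (n : nat) (rho : R) (theta : bool)
    (z : 'cV[R]_(n + n)) :
  R_obj rho theta (z *m z^T) = Ptheta_obj rho theta z.
Proof.
rewrite R_objE ?outer_sym// mxtrace_outer /Ptheta_obj.
under [X in _ + _ * X]eq_bigr do rewrite outerE.
by case: theta; rewrite ?mul1r// mul0r mulr0 mul0r addr0.
Qed.

Lemma R_feasible_outer (R : realType) (n : nat) (hn : (1 < n)%N) (A : 'M[R]_n)
    (r : R) (K : set 'M[R]_(n + n)) (theta : bool) (z : 'cV[R]_(n + n)) :
  K = @psd_cone R (n + n) \/ K = @dnn_cone R (n + n) ->
  Ptheta_feasible hn A r theta z -> R_feasible hn A r K theta (z *m z^T).
Proof.
move=> hK hz.
have [hA hr z1 z_ge0] : [/\ forall i j, (i, j) \in Omega n ->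
      let c := A i j - z (lshift n i) 0 * z (rshift n j) 0 in
      if theta return Prop then c <= 0 else c = 0,
    \sum_i z i 0 ^+ 2 <= r, z (fst_idx hn) 0 = 1 & forall i, 0 <= z i 0].
  by case: theta hz.
split.
- case: hK => ->; first exact: outer_psd.
  split; first exact: outer_psd.
  by move=> i j; rewrite outerE mulr_ge0.
- move=> i j /hA; rewrite frob_entry_constraint ?outer_sym ?outerE ?z1 ?mulr1//.
  by case: theta {hz hA} => /= [|->]; [lra|rewrite mulr0].
- by rewrite frobBl frob1l frobZl frob_symE_diag outerE z1 mxtrace_outer; lra.
- by rewrite outerE z1 mulr1.
- move=> j jN1; rewrite frob_symE ?outer_sym ?(eq_sym _ j)//.
  by rewrite outerE !mulr_ge0.
Qed.

(** * The weighted cycle *)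

Lemma Omega_diag (n : nat) (j : 'I_n) : (j, j) \in Omega n.
Proof. by rewrite inE eqxx. Qed.

Lemma val_ordS (n : nat) (j : 'I_n) : (j.+1 < n)%N -> val (ordS j) = j.+1.
Proof. by move=> hj; rewrite /= modn_small. Qed.

Lemma val_ordS_last (n : nat) (j : 'I_n) :
  ~~ (j.+1 < n)%N -> val (ordS j) = 0%N.
Proof.
move=> hj; have /= -> : j.+1 = n by have := ltn_ord j; lia.
by rewrite modnn.
Qed.

(** Together with [Omega_diag] this traverses the cycle: [ordS] is the cyclic
    successor, so the last index yields the edge joining u_1 and v_n. *)
Lemma Omega_ordS (n : nat) (j : 'I_n) : (ordS j, j) \in Omega n.
Proof.
rewrite inE; apply/orP; right; have [hj|hj] := boolP (j.+1 < n)%N.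
  by rewrite val_ordS ?eqxx.
by apply/orP; right; rewrite val_ordS_last//=; have := ltn_ord j; lia.
Qed.

(** The weight of the edge joining u_j and v_j: the solution of the equations on
    the vertex totals that vanishes at the last j. *)
Definition tail_gap (R : realType) (n : nat) (u v : 'I_n -> R) (j : 'I_n) : R :=
  \sum_(l : 'I_n | (j <= l)%N && (l.+1 < n)%N) (v l ^+ 2 - u (ordS l) ^+ 2).

Section TailGap.
Context (R : realType) (n : nat) (u v : 'I_n -> R).
Implicit Types i j : 'I_n.

Lemma tail_gap_last j : ~~ (j.+1 < n)%N -> tail_gap u v j = 0.
Proof. by move=> hj; rewrite /tail_gap big_pred0// => l; lia. Qed.

Lemma tail_gap_step j : (j.+1 < n)%N ->
  tail_gap u v j = v j ^+ 2 - u (ordS j) ^+ 2 + tail_gap u v (ordS j).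
Proof.
move=> hj; rewrite /tail_gap (bigD1 j) ?leqnn//=; congr (_ + _).
by apply: eq_bigl => l; rewrite modn_small// -val_eqE /=; lia.
Qed.

Context (u_ge0 : forall i, 0 <= u i).
Context (le_uv : forall i j, (i, j) \in Omega n -> u i <= v j).
Context (ratio_uv : forall i j, (i, j) \in Omega n ->
  (n%:R - 1) * v j ^+ 2 <= n%:R * u i ^+ 2).

Lemma tail_gap_ge0 j : 0 <= tail_gap u v j.
Proof.
apply: sumr_ge0 => l _; rewrite subr_ge0 lerXn2r ?nnegrE ?u_ge0//.
  exact: le_trans (u_ge0 l) (le_uv (Omega_diag l)).
exact: le_uv (Omega_ordS l).
Qed.

(** Where the constant 1 + 1 / (n - 1) matters: with indices starting at 0, each
    step down from j + 1 to j raises the bound on the ratio of [tail_gap] to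
    u_j^2 by exactly 1 / (n - 1), and at most n - 1 steps are taken, so that
    this ratio never exceeds 1. *)
Lemma tail_gap_bound j :
  (n%:R - 1) * tail_gap u v j <= (n%:R - 1 - j%:R) * u j ^+ 2.
Proof.
have n1_ge0 : 0 <= n%:R - 1 :> R.
  by rewrite subr_ge0 ler1n (leq_trans _ (ltn_ord j)).
have [m] := ubnP (n - j)%N; elim: m j => // m IHm j lt_m.
have [hj|hj] := boolP (j.+1 < n)%N; last first.
  rewrite tail_gap_last// mulr0 mulr_ge0 ?sqr_ge0// -addrA -opprD subr_ge0.
  by rewrite nat1r ler_nat.
have lt_m' : (n - ordS j < m)%N by rewrite val_ordS//; lia.
have := IHm _ lt_m'; rewrite val_ordS// (tail_gap_step hj).
have := ratio_uv (Omega_diag j); have := ratio_uv (Omega_ordS j).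
set X := tail_gap _ _ _; set U := u (ordS j) ^+ 2.
set V := v j ^+ 2; set W := u j ^+ 2.
have := hj; rewrite -(ler_nat R) -[j.+2]addn1 natrD -natr1.
have : 0 <= j%:R :> R by [].
move: (n%:R : R) (j%:R : R) n1_ge0 => N J N1 J0 JN UV VW XU.
have N0 : 0 < N by lra.
rewrite -(ler_pM2l N0).
(* With X the gap at j + 1, N (N - 1) (V - U + X) is at most
     N (N - 1) V - (J + 1) N U <= (N - 1 - J) (N - 1) V <= (N - 1 - J) N W. *)
have jump := ler_wpM2l (addr_ge0 J0 ler01) UV.
have stay := ler_wpM2l (_ : 0 <= N - 1 - J) VW.
have rest := ler_wpM2l (ltW N0) XU.
move: stay => /(_ ltac:(lra)) stay; lra.
Qed.

Lemma tail_gap_le_sqr j : (1 < n)%N -> tail_gap u v j <= u j ^+ 2.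
Proof.
move=> hn; have n1_gt0 : 0 < n%:R - 1 :> R by rewrite subr_gt0 ltr1n.
rewrite -(ler_pM2l n1_gt0); apply: le_trans (tail_gap_bound j) _.
by rewrite ler_wpM2r ?sqr_ge0// gerBl ler0n.
Qed.

(** The certificate. The weights are extended by 0 outside Omega, so that the
    vertex totals are full row and column sums. *)
Lemma cycle_weights : (1 < n)%N -> exists x : 'I_n -> 'I_n -> R,
  [/\ forall i j, 0 <= x i j, forall i j, (i, j) \notin Omega n -> x i j = 0,
      forall j, \sum_i x i j = v j ^+ 2
    & forall i, val i != 0%N -> \sum_j x i j = u i ^+ 2].
Proof.
move=> hn; pose X := tail_gap u v.
have sum_delta i (F : 'I_n -> R) : \sum_j (i == j)%:R * F j = F i.
  rewrite (bigD1 i)//= eqxx mul1r big1 ?addr0// => k /negbTE.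
  by rewrite eq_sym => ->; rewrite mul0r.
have next_weight j : (j.+1 < n)%N ->
    v j ^+ 2 - X j = u (ordS j) ^+ 2 - X (ordS j).
  by move=> hj; rewrite /X tail_gap_step//; ring.
exists (fun i j =>
  (i == j)%:R * X j + (ordS j == i)%:R * (v j ^+ 2 - X j)); split.
- move=> i j; rewrite addr_ge0// mulr_ge0 ?tail_gap_ge0//.
  have [hj|hj] := boolP (j.+1 < n)%N.
    by rewrite next_weight// subr_ge0 tail_gap_le_sqr.
  by rewrite /X tail_gap_last// subr0 sqr_ge0.
- move=> i j; case: eqP => [->|_]; first by rewrite Omega_diag.
  case: eqP => [<-|_]; first by rewrite Omega_ordS.
  by rewrite !mul0r addr0.
- move=> j; rewrite big_split /=.
  under eq_bigr do rewrite eq_sym.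
  rewrite sum_delta.
  by rewrite (sum_delta (ordS j) (fun=> v j ^+ 2 - X j)) addrC subrK.
- move=> i i_neq0; rewrite big_split /= sum_delta.
  under eq_bigr do rewrite (can2_eq (@ordSK n) (@ord_predK n)) eq_sym.
  rewrite sum_delta next_weight ?ord_predK; first by rewrite addrC subrK.
  rewrite ltnNge; apply: contra i_neq0 => le_n; apply/eqP.
  by rewrite -[i]ord_predK val_ordS_last// -leqNgt.
Qed.

End TailGap.

(** * The lower bound *)

(** Weak duality with the weights of [cycle_weights]; the unspecified total [d]
    of the weights at the first vertex cancels, as u and Z are both 1 there. *)
Lemma trace_ge_of_ratio (R : realType) (n : nat) (hn : (1 < n)%N)
    (z : 'cV[R]_(n + n)) (Z : 'M[R]_(n + n)) :
  let u i := z (lshift n i) 0 in let v j := z (rshift n j) 0 in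
  z (fst_idx hn) 0 = 1 -> (forall i, 0 < z i 0) ->
  (forall i j, (i, j) \in Omega n -> u i <= v j) ->
  (forall i j, (i, j) \in Omega n ->
     (n%:R - 1) * v j ^+ 2 <= n%:R * u i ^+ 2) ->
  psd_cone Z -> Z (fst_idx hn) (fst_idx hn) = 1 ->
  (forall i j, (i, j) \in Omega n ->
     u i * v j <= Z (lshift n i) (rshift n j)) ->
  \sum_i z i 0 ^+ 2 <= \tr Z.
Proof.
move=> u v z1 z_gt0 le_uv ratio_uv Zpsd Z1 Zge.
have u_gt0 i : 0 < u i by exact: z_gt0.
have v_gt0 j : 0 < v j by exact: z_gt0.
have u_ge0 i := ltW (u_gt0 i).
have [x [x_ge0 x_supp colx rowx]] := cycle_weights u_ge0 le_uv ratio_uv hn.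
pose L i := Z (lshift n i) (lshift n i); pose Q j := Z (rshift n j) (rshift n j).
have edge i j :
    2 * x i j <= x i j * (L i / u i ^+ 2) + x i j * (Q j / v j ^+ 2).
  have [ij|/x_supp->] := boolP ((i, j) \in Omega n); last first.
    by rewrite !mul0r mulr0 addr0.
  rewrite -mulrDr mulrC; apply: ler_wpM2l => //.
  rewrite (mulrC (L i)) (mulrC (Q j)) -!exprVn.
  apply: le_trans (psd_cone_quad2 _ _ _ _ Zpsd).
  by rewrite ler_peMr// -invfM mulrC ler_pdivlMr ?mulr_gt0// mul1r Zge.
pose i0 : 'I_n := Ordinal (ltnW hn); pose d := \sum_j x i0 j.
have neq0 (i : 'I_n) : i != i0 -> val i != 0%N by [].
have u0 : u i0 = 1 := z1.
have L0 : L i0 = 1 := Z1.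
(* The total weight is written once by columns and once by rows, so that twice
   it is [d] plus all the squares of the coordinates of z but the first. *)
have sum_cols : \sum_i \sum_j x i j = \sum_j v j ^+ 2.
  by rewrite exchange_big; apply: eq_bigr => j _ /=; exact: colx.
have sum_rows : \sum_i \sum_j x i j = d + \sum_(i | i != i0) u i ^+ 2.
  rewrite (bigD1 i0)//=; congr (_ + _).
  by apply: eq_bigr => i /neq0 /rowx->.
have sum_L : \sum_i \sum_j x i j * (L i / u i ^+ 2)
    = d + \sum_(i | i != i0) L i.
  under eq_bigr do rewrite -mulr_suml.
  rewrite (bigD1 i0)//= u0 L0 expr1n divr1 mulr1; congr (_ + _).
  by apply: eq_bigr => i /neq0 /rowx->; rewrite mulrC divfK// expf_neq0// gt_eqF.
have sum_Q : \sum_i \sum_j x i j * (Q j / v j ^+ 2) = \sum_j Q j.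
  rewrite exchange_big; apply: eq_bigr => j _ /=.
  by rewrite -mulr_suml colx mulrC divfK// expf_neq0// gt_eqF.
have : 2 * \sum_i \sum_j x i j
    <= d + \sum_(i | i != i0) L i + \sum_j Q j.
  rewrite -sum_L -sum_Q -big_split mulr_sumr; apply: ler_sum => i _ /=.
  by rewrite -big_split mulr_sumr; apply: ler_sum => j _ /=; exact: edge.
have -> : \tr Z = 1 + \sum_(i | i != i0) L i + \sum_j Q j.
  by rewrite /mxtrace big_split_ord (bigD1 i0)//= -[Z _ _]/(L i0) L0.
have -> : \sum_i z i 0 ^+ 2
    = 1 + \sum_(i | i != i0) u i ^+ 2 + \sum_j v j ^+ 2.
  by rewrite big_split_ord (bigD1 i0)//= -[z _ _]/(u i0) u0 expr1n.
rewrite mulr_natl mulr2n {1}sum_rows sum_cols => bound.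
rewrite -!addrA lerD2l -(lerD2l d) !addrA; exact: bound.
Qed.

(** * From the factorization problem to its relaxation *)

Lemma P_feasible_Ptheta (R : realType) (n : nat) (hn : (1 < n)%N)
    (A : 'M[R]_n) (r : R) (theta : bool) (z : 'cV[R]_(n + n)) :
  P_feasible hn A r z -> Ptheta_feasible hn A r theta z.
Proof. by case: theta => // -[zA *]; split=> // i j /zA ->. Qed.

(** Each vertex of the cycle meets a diagonal edge, whose product is nonzero. *)
Lemma P_feasible_gt0 (R : realType) (n : nat) (hn : (1 < n)%N)
    (A : 'M[R]_n) (r : R) (z : 'cV[R]_(n + n)) :
  (forall i j, (i, j) \in Omega n -> 0 < A i j) ->
  P_feasible hn A r z -> forall k, 0 < z k 0.
Proof.
move=> A_gt0 [zA _ _ z_ge0] k; rewrite lt0r z_ge0 andbT.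
have zA_neq0 i : z (lshift n i) 0 * z (rshift n i) 0 != 0.
  have := zA i i (Omega_diag i) => /eqP; rewrite subr_eq0 => /eqP <-.
  by rewrite gt_eqF// A_gt0 ?Omega_diag.
by case: (split_ordP k) => i ->; have := zA_neq0 i; rewrite mulf_eq0 negb_or;
  case/andP.
Qed.

Lemma ratio_sqr (R : realType) (n : nat) (a b : R) : (1 < n)%N -> 0 < a ->
  1 <= b / a <= Num.sqrt (1 + 1 / (n%:R - 1)) ->
  a <= b /\ (n%:R - 1) * b ^+ 2 <= n%:R * a ^+ 2.
Proof.
move=> hn a_gt0 /andP[ge1 le_sqrt].
have n1_gt0 : 0 < n%:R - 1 :> R by rewrite subr_gt0 ltr1n.
split; first by move: ge1; rewrite ler_pdivlMr// mul1r.
have : (b / a) ^+ 2 <= 1 + 1 / (n%:R - 1).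
  rewrite -[leRHS]sqr_sqrtr; last by rewrite addr_ge0// divr_ge0// ltW.
  by rewrite lerXn2r ?nnegrE ?sqrtr_ge0// (le_trans _ ge1).
rewrite expr_div_n ler_pdivrMr ?exprn_gt0// => le_b.
apply: le_trans (ler_wpM2l (ltW n1_gt0) le_b) _.
by rewrite le_eqVlt; apply/orP; left; apply/eqP; field; rewrite gt_eqF.
Qed.

(** Embedding the feasible set gives one inequality between the infima, and the
    minimizer in the image of the embedding gives the other. *)
Lemma optimal_value_relaxation (R : realType) (S T : Type) (C : set S)
    (f : S -> R) (D : set T) (g : T -> R) (lift : S -> T) (x : S) :
  optimal_solution D g (lift x) -> C x ->
  (forall y, C y -> D (lift y) /\ g (lift y) = f y) ->
  optimal_value D g = optimal_value C f.
Proof.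
move=> [_ opt] Cx hlift; apply/eqP; rewrite eq_le; apply/andP; split.
  apply: ereal_inf_le_tmp => _ [y Cy <-]; have [Dy gy] := hlift y Cy.
  by exists (lift y) => //; rewrite gy.
apply: le_trans (_ : (f x)%:E <= _)%E.
  by apply: ereal_inf_lbound; exists x.
apply: le_ereal_inf_tmp => _ [y Dy <-]; rewrite lee_fin -(hlift x Cx).2; exact: opt.
Qed.

Theorem theorem4p6 (R : realType) (n : nat) (hn : (1 < n)%N) (A : 'M[R]_n)
    (hA : forall i j, (i, j) \in Omega n -> 0 < A i j) :
  exists r0 rho0 : R, [/\ 0 < r0, 0 < rho0 &
    forall r rho : R, r0 <= r -> rho0 <= rho ->
    forall (z : 'cV[R]_(n + n)) (K : set 'M[R]_(n + n)),
      optimal_solution (P_feasible hn A r) (@P_obj R n) z ->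
      K = @psd_cone R (n + n) \/ K = @dnn_cone R (n + n) ->
      (forall i j, (i, j) \in Omega n ->
         1 <= z (rshift n j) 0 / z (lshift n i) 0
           <= Num.sqrt (1 + 1 / (n%:R - 1))) ->
      [/\ forall theta : bool,
            optimal_solution (R_feasible hn A r K theta) (R_obj rho theta)
              (z *m z^T)
            /\ \rank (z *m z^T) = 1%N,
          optimal_value (R_feasible hn A r K false) (@R_obj R n rho false)
            = optimal_value (P_feasible hn A r) (@P_obj R n)
        & optimal_value (R_feasible hn A r K true) (@R_obj R n rho true)
            = optimal_value (P'_feasible hn A r) (P'_obj rho)]].
Proof.
exists 1, 1; split=> // r rho _ rho_ge1 z K [z_feas _] hK ratio.
have rho_ge0 : 0 <= rho by apply: le_trans rho_ge1.
have z1 : z (fst_idx hn) 0 = 1 by case: z_feas.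
have z_gt0 := P_feasible_gt0 hA z_feas.
have zA i j : (i, j) \in Omega n -> z (lshift n i) 0 * z (rshift n j) 0 = A i j.
  by case: z_feas => + _ _ _ => /[apply] /eqP; rewrite subr_eq0 => /eqP.
have Kpsd Z : K Z -> psd_cone Z by case: hK => -> // [].
have opt theta :
    optimal_solution (R_feasible hn A r K theta) (R_obj rho theta) (z *m z^T).
  split; first exact: R_feasible_outer (P_feasible_Ptheta theta z_feas).
  move=> Z [/Kpsd Zpsd Zcon _ Z1 _]; have symZ : Z^T = Z by case: Zpsd.
  have ZA i j : (i, j) \in Omega n -> A i j <= Z (lshift n i) (rshift n j).
    move=> /Zcon; rewrite frob_entry_constraint// /=.
    by case: theta {Zcon} => h; lra.
  rewrite !R_objE ?outer_sym// mxtrace_outer; apply: lerD.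
    apply: (trace_ge_of_ratio z1 z_gt0 _ _ Zpsd Z1) => i j ij.
    - exact: (ratio_sqr hn (z_gt0 _) (ratio i j ij)).1.
    - exact: (ratio_sqr hn (z_gt0 _) (ratio i j ij)).2.
    - by rewrite zA// ZA.
  rewrite ler_wpM2l ?mulr_ge0//; apply: ler_sum => -[i j] ij.
  by rewrite outerE zA// ZA.
have tight theta :
    optimal_value (R_feasible hn A r K theta) (@R_obj R n rho theta)
    = optimal_value (Ptheta_feasible hn A r theta) (Ptheta_obj rho theta).
  apply: (@optimal_value_relaxation _ _ _ _ _ _ _ (fun y => y *m y^T) z) => //.
    exact: P_feasible_Ptheta z_feas.
  by move=> y hy; rewrite R_obj_outer; split=> //; exact: R_feasible_outer.
split=> [theta||]; [split; [exact: opt|exact: rank_outer z1]| |].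
- exact: tight false.
- exact: tight true.
Qed.
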